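(* Let $L\ge1$ and $D\ge 2$ be integers, let $\rho_1,\dots,\rho_D>0$, and for $d=1,\dots,D$ set $\sigma_d^2=\frac{1}{1+\rho_d L}$ and $G_d=\frac{1}{\rho_d(1-\sigma_d^2)}$. Suppose a single access point transmits to $D$ devices, the $d$th having measurement noise-to-signal ratio $G_d$: let $\hat h_1,\dots,\hat h_D$ be independent with $\hat h_d\sim\mathcal{CN}(0,1-\sigma_d^2)$, and let $Y_d=\frac{1}{\log_2(1+\rho_d|\hat h_d|^2)}$. Let $\overline{G}_D=\frac1D\sum_{d=1}^D G_d$. Then for every $y>0$, $$\exp\left(-D\,\overline{G}_D\left(2^{D/y}-1\right)\right)\le\mathbb{P}\left[\sum_{d=1}^D Y_d\le y\right]\le\exp\left(-D\,\overline{G}_D\left(2^{1/y}-1\right)\right).$$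
   Context: $\mathcal{CN}(0,s)$ denotes the circularly symmetric complex Gaussian distribution with mean $0$ and variance $s$ (so $X\sim\mathcal{CN}(0,s)$ has $\mathbb{E}|X|^2=s$). $\hat h_d$ is the MMSE channel estimate for device $d$ (average SNR $\rho_d$) from $L$ pilots, with error variance $\sigma_d^2$. With bandwidth $W$, the rate selected for device $d$ is $R_d=W\log_2(1+\rho_d|\hat h_d|^2)$, and $Y_d=W/R_d$ is the time needed to transmit one bit in one Hertz. The probability bounded is that of time underflow with respect to the deadline $y$. *)

(* Defs.v *)
From HB Require Import structures.
From mathcomp Require Import all_boot all_order all_algebra complex.
From mathcomp Require Import all_classical all_reals all_analysis.

Set Implicit Arguments.
Unset Strict Implicit.
Unset Printing Implicit Defensive.

Import Order.TTheory GRing.Theory Num.Theory.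
Import numFieldNormedType.Exports.

Local Open Scope classical_set_scope.
Local Open Scope complex_scope.
Local Open Scope ring_scope.

Section complex_measurable.
Variable R : realType.

HB.instance Definition _ := isPointed.Build R[i] 0.

Definition complex_of_pair (u : R * R) : R[i] := u.1 +i* u.2.

(* [complex_of_pair] is a bijection, so this transports the product (Borel)
   sigma-algebra of R * R, i.e., it yields the Borel sets of the plane. *)
Definition complex_measurable : set (set R[i]) :=
  [set A | measurable (complex_of_pair @^-1` A)].

Let complex_measurable0 : complex_measurable set0.
Proof. by rewrite /complex_measurable /= preimage_set0. Qed.

Let complex_measurableC A : complex_measurable A -> complex_measurable (~` A).
Proof. by move=> mA; rewrite /complex_measurable /= -preimage_setC; exact: measurableC. Qed.

Let complex_measurable_bigcup (F : (set R[i])^nat) :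
  (forall i, complex_measurable (F i)) -> complex_measurable (\bigcup_i F i).
Proof.
by move=> mF; rewrite /complex_measurable /= preimage_bigcup; exact: bigcupT_measurable.
Qed.

HB.instance Definition _ := isMeasurable.Build default_measure_display R[i]
  complex_measurable0 complex_measurableC complex_measurable_bigcup.

End complex_measurable.

(* CN(0, s), for s > 0: independent real and imaginary parts, each N(0, s/2).
   The second parameter of [normal_prob] is a standard deviation. *)
Definition complex_normal (R : realType) (s : R) : set R[i] -> \bar R :=
  pushforward (normal_prob 0 (Num.sqrt (s / 2)) \x
               normal_prob 0 (Num.sqrt (s / 2)))%E (@complex_of_pair R).

(* Both sides are compared on measurable sets only: the values of the
   underlying set functions elsewhere are meaningless. *)
Definition has_law d d' (T : measurableType d) (T' : measurableType d')
    (R : realType) (P : probability T R) (X : {RV P >-> T'})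
    (mu : set T' -> \bar R) : Prop :=
  forall A : set T', measurable A -> distribution P X A = mu A.

Definition independent_RVs d d' (T : measurableType d) (T' : measurableType d')
    (R : realType) (P : probability T R) (I : finType)
    (X : I -> {RV P >-> T'}) : Prop :=
  forall (J : {set I}) (A : I -> set T'), (forall i, measurable (A i)) ->
    P (\bigcap_(i in [set` J]) (X i @^-1` A i)) =
    (\prod_(i in J) P (X i @^-1` A i))%E.

Definition log2 (R : realType) (x : R) : R := ln x / ln 2.

Definition error_variance (R : realType) (L : nat) (rho : R) : R :=
  1 / (1 + rho * L%:R).

Definition noise_to_signal (R : realType) (L : nat) (rho : R) : R :=
  1 / (rho * (1 - error_variance L rho)).

Definition mean_noise_to_signal (R : realType) (L D : nat) (rho : 'I_D -> R) : R :=
  D%:R^-1 * \sum_(d < D) noise_to_signal L (rho d).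

(* The inverse is that of [\bar R], where [0^-1 = +oo]: a zero channel estimate
   gives an infinite transmission time. *)
Definition bit_time (R : realType) (rho : R) (z : R[i]) : \bar R :=
  ((log2 (1 + rho * Normc.normc z ^+ 2))%:E^-1)%E.

(* Main.v *)
(* The heart of the matter is that |h_d|^2 is exponentially distributed:
   P(|h_d|^2 >= c) = exp (- c / s) when h_d ~ CN(0, s).  Substituting y = |x| u
   in the inner integral and exchanging the integrals gives
     \int\int f(x^2 + y^2) dy dx = (\int du / (1 + u^2)) (\int |r| f(r^2) dr),
   so the tail is k exp (- c / s) for some k independent of c, and k = 1 is read
   off at c = 0 without evaluating the arctangent integral.  Hence
   P(Y_d <= t) = exp (- G_d (2^(1/t) - 1)), and by independence the product of
   these over d is the probability that all Y_d <= t.  As the Y_d are nonnegative,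
     {all Y_d <= y / D} `<=` {\sum Y_d <= y} `<=` {all Y_d <= y}. *)

Require Import Defs.
From HB Require Import structures.
From mathcomp Require Import all_boot all_order all_algebra complex.
From mathcomp Require Import all_classical all_reals all_analysis.
From mathcomp Require Import measurable_realfun ring.

Set Implicit Arguments.
Unset Strict Implicit.
Unset Printing Implicit Defensive.

Import Order.TTheory GRing.Theory Num.Theory.
Import numFieldNormedType.Exports.

Local Open Scope classical_set_scope.
Local Open Scope complex_scope.
Local Open Scope ring_scope.

(** * Linear change of variables for the Lebesgue measure *)

Section lebesgue_scaling.
Variable R : realType.
Local Notation mu := (@lebesgue_measure R).

(** Lebesgue measure is determined by its values on the intervals []b, c]], where the factor [a]
    compensates the division of both endpoints by [a]. *)
Lemma lebesgue_measure_scale (a : R) (A : set R) : 0 < a -> measurable A ->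
  (mu A = a%:E * mu ((fun x => a * x)%R @^-1` A))%E.
Proof.
move=> a0 mA.
have mf : measurable_fun setT
    (fun x : measurableTypeR R => a * x : measurableTypeR R).
  exact: measurable_funM.
pose phi (x : measurableTypeR R) : measurableTypeR R := a * x.
pose k : {nonneg R} := NngNum (ltW a0).
rewrite (@lebesgue_measure_unique R (mscale k (pushforward mu phi)))//.
move=> _ [[b c] /= _ <-]; rewrite /mscale/= /pushforward.
rewrite [X in (_ * _ X)%E](_ : _ = `]a^-1 * b, a^-1 * c]%classic); last first.
  by apply/seteqP; split=> x /=; rewrite !in_itv/= ltr_pdivrMl// ler_pdivlMl//.
rewrite !lebesgue_measure_itv/= !lte_fin ltr_pM2l ?invr_gt0//.
case: ifPn => _; last by rewrite mule0.
by rewrite -!EFinB -EFinM -mulrBr mulrA divff ?gt_eqF// mul1r.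
Qed.

(** The measure is transported rather than an antiderivative, so [f] may be discontinuous, as a
    truncated exponential is. *)
Lemma ge0_integral_scale (a : R) (f : R -> \bar R) : 0 < a ->
  measurable_fun setT f -> (forall x, 0 <= f x)%E ->
  (\int[mu]_x f x = a%:E * \int[mu]_x f (a * x)%R)%E.
Proof.
move=> a0 mf f0.
have mphi : measurable_fun setT
    (fun x : measurableTypeR R => a * x : measurableTypeR R).
  exact: measurable_funM.
pose phi (x : measurableTypeR R) : measurableTypeR R := a * x.
pose k : {nonneg R} := NngNum (ltW a0).
rewrite (eq_measure_integral (mscale k (pushforward mu phi))); last first.
  by move=> A mA _; exact: lebesgue_measure_scale.
rewrite ge0_integral_mscale//= (ge0_integral_pushforward mphi)//.
Qed.

End lebesgue_scaling.

(** * Integrals of radial functions over the plane *)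

Section radial_integral.
Variable R : realType.
Local Notation mu := (@lebesgue_measure R).

(** A substitute for polar coordinates, in which the slope [u = y / |x|] replaces the angle. *)
Lemma integral_radial (f : R -> \bar R) :
  measurable_fun setT f -> (forall x, 0 <= f x)%E ->
  (\int[mu]_x \int[mu]_y f (x ^+ 2 + y ^+ 2)%R =
   (\int[mu]_u ((1 + u ^+ 2)^-1)%:E) * \int[mu]_r (`|r|%:E * f (r ^+ 2)%R))%E.
Proof.
move=> mf f0.
(* The integrand after [y = |x| u]: the Jacobian is [|x|], and [x ^+ 2 + y ^+ 2] becomes
   [x ^+ 2 * (1 + u ^+ 2)]. *)
pose g (z : R * R) := (`|z.1|%:E * f (z.1 ^+ 2 * (1 + z.2 ^+ 2))%R)%E.
have mg : measurable_fun setT g.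
  apply: emeasurable_funM.
    by apply/measurable_EFinP; apply: measurableT_comp => //; exact: measurable_fst.
  apply: measurableT_comp => //; apply: measurable_funM.
    by apply: measurable_funX; exact: measurable_fst.
  by apply: measurable_funD => //; exact: measurable_funX.
have g0 z : (0 <= g z)%E by rewrite mule_ge0.
pose h (z : R * R) := f (z.1 ^+ 2 + z.2 ^+ 2).
have mh : measurable_fun setT h.
  apply: measurableT_comp => //; apply: measurable_funD.
    by apply: measurable_funX; exact: measurable_fst.
  by apply: measurable_funX; exact: measurable_snd.
have h0 z : (0 <= h z)%E by exact: f0.
have mH : measurable_fun setT (fun r : R => `|r|%:E * f (r ^+ 2)%R)%E.
  apply: emeasurable_funM.
    by apply/measurable_EFinP; exact: normr_measurable.
  by apply: measurableT_comp => //; exact: measurable_funX.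
have mI : measurable_fun setT (fun u : R => ((1 + u ^+ 2)^-1)%R).
  apply: continuous_measurable_fun => u; apply: cvgV.
    by rewrite gt_eqF// ltr_pwDl// sqr_ge0.
  by apply: cvgD; [exact: cvg_cst|exact: exprn_continuous].
transitivity (\int[mu]_x \int[mu]_u g (x, u))%E.
  (* The substitution degenerates at [x = 0], so the inner integrals are compared only outside the
     null set [[set 0]]. *)
  apply: ge0_ae_eq_integral => //.
  - exact: (measurable_fun_fubini_tonelli_F (m2 := mu) h).
  - exact: (measurable_fun_fubini_tonelli_F (m2 := mu) g).
  - by move=> x _; exact: integral_ge0.
  - by move=> x _; exact: integral_ge0.
  exists [set 0]; split=> //; first exact: lebesgue_measure_set1.
  move=> x /= /not_implyP[_]; apply: contra_notP => /eqP x0.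
  have mfx : measurable_fun setT (fun y : R => f (x ^+ 2 + y ^+ 2)).
    by apply: measurableT_comp => //; exact: measurable_funD.
  rewrite (ge0_integral_scale (a := `|x|)) ?normr_gt0//.
  rewrite -ge0_integralZl//=.
    apply: eq_integral => u _.
    by rewrite /g/= exprMn real_normK ?num_real// mulrDr mulr1.
  by apply: (measurableT_comp mfx); exact: measurable_funM.
transitivity (\int[mu]_u \int[mu]_x g (x, u))%E.
  exact: (fubini_tonelli (m1 := mu) (m2 := mu) g).
rewrite -ge0_integralZr//; last 3 first.
- exact/measurable_EFinP.
- by move=> u _; rewrite lee_fin invr_ge0 addr_ge0// sqr_ge0.
- by apply: integral_ge0 => r _; rewrite mule_ge0.
apply: eq_integral => u _; rewrite /g/=.
have k0 : 0 < 1 + u ^+ 2 by rewrite ltr_pwDl// sqr_ge0.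
have s0 : 0 < Num.sqrt (1 + u ^+ 2) by rewrite sqrtr_gt0.
(* With [r = Num.sqrt (1 + u ^+ 2) * x], both [dr] and [|r|] contribute a square root; together they
   cancel [(1 + u ^+ 2)^-1]. *)
rewrite [in RHS](ge0_integral_scale s0)//; last by move=> r; rewrite mule_ge0.
have mHs : measurable_fun setT (fun x : R => `|Num.sqrt (1 + u ^+ 2) * x|%:E *
    f ((Num.sqrt (1 + u ^+ 2) * x) ^+ 2)%R)%E.
  by apply: (measurableT_comp mH); exact: measurable_funM.
rewrite -ge0_integralZl//=; last by move=> x _; rewrite mule_ge0.
rewrite -ge0_integralZl//=.
- apply: eq_integral => x _; rewrite normrM gtr0_norm// exprMn sqr_sqrtr ?ltW//.
  rewrite (mulrC (1 + u ^+ 2) (x ^+ 2)) EFinM !muleA -!EFinM.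
  rewrite -(mulrA _ _ (Num.sqrt _)).
  by rewrite -expr2 sqr_sqrtr ?ltW// mulVf ?gt_eqF// mul1r.
- exact: measurable_funeM.
- by move=> x _; rewrite !mule_ge0.
- by rewrite lee_fin invr_ge0 ltW.
Qed.

End radial_integral.

(** * The radial integral of a truncated exponential *)

Section gaussian_tail.
Variable R : realType.
Local Notation mu := (@lebesgue_measure R).

(** At [t = x ^+ 2 + y ^+ 2] this is, up to normalisation, the density of CN(0, s) cut off to the
    squared radii at least [c]. *)
Definition exp_tail (s c t : R) : R := expR (- (t / s)) * \1_`[c, +oo[ t.

Lemma exp_tail_ge0 s c t : 0 <= exp_tail s c t.
Proof. by rewrite mulr_ge0 ?expR_ge0. Qed.

Lemma measurable_exp_tail s c : measurable_fun setT (exp_tail s c).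
Proof.
apply: measurable_funM; last exact: measurable_indic.
apply: measurableT_comp => //; apply: measurableT_comp => //.
exact: measurable_funM.
Qed.

Lemma ge0_integral_even (f : R -> \bar R) :
  measurable_fun setT f -> (forall x, 0 <= f x)%E -> (forall x, f (- x)%R = f x) ->
  (\int[mu]_x f x = 2%:E * \int[mu]_(x in `[0%R, +oo[) f x)%E.
Proof.
move=> mf f0 ef.
rewrite -(setUv `[0%R, +oo[%classic) ge0_integral_setU//=; last 3 first.
- exact: measurableC.
- by rewrite setUv.
- exact/disj_setPCl.
rewrite setCitvr mule_natl mule2n; congr (_ + _)%E.
(* Adding the null endpoint 0 gives the closed half-line that [x -> - x] exchanges with [[0,
   +oo[]. *)
rewrite integral_itv_bndo_bndc; last exact: measurable_funTS.
rewrite ge0_integration_by_substitution0//.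
by apply: eq_integral => x _; rewrite ef.
Qed.

(** The factor [x] provides the elementary antiderivative [F], which tends to 0 at infinity. *)
Lemma integral_gaussian_tail (s a : R) : 0 < s -> 0 <= a ->
  (\int[mu]_(x in `[a, +oo[) (x * expR (- (x ^+ 2 / s)))%:E =
   (s / 2 * expR (- (a ^+ 2 / s)))%:E)%E.
Proof.
move=> s0 a0.
pose F x : R := - (s / 2 * expR (- (x ^+ 2 / s))).
have dF (x : R) : is_derive x 1 F (x * expR (- (x ^+ 2 / s))).
  rewrite /F; apply: is_derive_eq.
  rewrite /GRing.scale/=.
  by field; rewrite gt_eqF.
have cF x : {for x, continuous F}.
  by apply: differentiable_continuous; apply/derivable1_diffP; have [] := dF x.
rewrite (@ge0_continuous_FTC2y _ _ F _ 0).
- by rewrite -EFinB sub0r opprK.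
- by move=> x ax; rewrite mulr_ge0 ?expR_ge0// (le_trans a0).
- apply: continuous_subspaceT => x.
  apply: cvgM; first exact: cvg_id.
  apply: (cvg_comp _ expR); last exact: continuous_expR.
  apply: cvgN; apply: cvgM; [exact: exprn_continuous|exact: cvg_cst].
(* The limit 0 is rewritten as [- (s / 2 * 0)] to follow the shape of [F]. *)
- rewrite -[0]oppr0 -[X in - X](mulr0 (s / 2)).
  apply: cvgN; apply: cvgM; first exact: cvg_cst.
  apply: (@cvg_comp _ _ _ (fun x : R => x ^+ 2 / s) (fun y => expR (- y)) _
    (pinfty_nbhs R)); last exact: cvgr_expR.
  by apply: gt0_cvgMly; [rewrite invr_gt0|exact: cvgr_expr2].
- by move=> x _; have [] := dF x.
- by apply: cvg_at_right_filter; exact: cF.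
- by move=> x _; rewrite derive1E; apply: derive_val.
Qed.

(** By evenness this is twice the integral over [r >= 0], where [c <= r ^+ 2] means
    [Num.sqrt c <= r]. *)
Lemma integral_radial_exp_tail (s c : R) : 0 < s -> 0 <= c ->
  (\int[mu]_r (`|r|%:E * (exp_tail s c (r ^+ 2))%:E) = (s * expR (- (c / s)))%:E)%E.
Proof.
move=> s0 c0; rewrite ge0_integral_even; last 3 first.
- apply/measurable_EFinP; apply: measurable_funM => //.
  by apply: measurableT_comp; [exact: measurable_exp_tail|exact: measurable_funX].
- by move=> x; rewrite mule_ge0// lee_fin exp_tail_ge0.
- by move=> x; rewrite normrN sqrrN.
transitivity (2%:E *
    \int[mu]_(x in `[Num.sqrt c, +oo[) (x * expR (- (x ^+ 2 / s)))%:E)%E.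
  congr (_ * _)%E; rewrite integral_mkcond [RHS]integral_mkcond.
  apply: eq_integral => x _; rewrite !patchE !mem_setE !in_itv/= !andbT.
  case: ifPn => [x0|].
    rewrite /exp_tail indicE mem_setE in_itv/= andbT -EFinM ger0_norm//.
    have -> : (Num.sqrt c <= x) = (c <= x ^+ 2).
      by rewrite -[RHS]ler_sqrt ?sqr_ge0// sqrtr_sqr ger0_norm.
    by case: ifPn; rewrite ?mulr1 ?mulr0 ?mule0.
  rewrite -ltNge => x0; rewrite ifF//; apply/negbTE.
  by rewrite -ltNge (lt_le_trans x0) ?sqrtr_ge0.
rewrite integral_gaussian_tail ?sqrtr_ge0// sqr_sqrtr// -EFinM; congr EFin.
by field.
Qed.

End gaussian_tail.

(** * The tail of the squared modulus under CN(0, s) *)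

Section complex_normal_tail.
Variable R : realType.
Local Notation mu := (@lebesgue_measure R).

(** Both functions have the same integral over every measurable set. This identifies the abstract
    derivative with the explicit density. *)
Lemma ae_eq_Radon_Nikodym_normal_prob (m sigma : R) :
  ae_eq mu setT (Radon_Nikodym (charge_of_finite_measure (normal_prob m sigma)) mu)
    (fun x => (normal_pdf m sigma x)%:E).
Proof.
have dom : charge_of_finite_measure (normal_prob m sigma) `<< mu.
  exact: normal_prob_dominates.
apply: integral_ae_eq => //.
- exact: Radon_Nikodym_integrable.
- by apply/measurable_EFinP; exact: measurable_normal_pdf.
- by move=> E _ mE; rewrite -Radon_Nikodym_integral.
Qed.

Lemma integral_normal_prob (m sigma : R) (f : R -> \bar R) :
  (normal_prob m sigma).-integrable setT f ->
  (\int[normal_prob m sigma]_x f x =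
   \int[mu]_x (f x * (normal_pdf m sigma x)%:E))%E.
Proof.
move=> intf.
rewrite -(Radon_Nikodym_change_of_variables (normal_prob_dominates m sigma))//.
have mf := measurable_int _ intf.
apply: ae_eq_integral => //.
- apply: emeasurable_funM => //.
  apply: (measurable_int mu); apply: Radon_Nikodym_integrable.
  exact: normal_prob_dominates.
- apply: emeasurable_funM => //.
  by apply/measurable_EFinP; exact: measurable_normal_pdf.
- exact/ae_eqe_mul2l/ae_eq_Radon_Nikodym_normal_prob.
Qed.

(** The parameter is the squared radius; at [c = 0] the set is the whole plane. *)
Definition disk_complement (c : R) : set (R * R) :=
  [set z | c <= z.1 ^+ 2 + z.2 ^+ 2].

Lemma measurable_disk_complement c : measurable (disk_complement c).
Proof.
have mh : measurable_fun setT (fun z : R * R => z.1 ^+ 2 + z.2 ^+ 2).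
  apply: measurable_funD; apply: measurable_funX.
    exact: measurable_fst.
  exact: measurable_snd.
rewrite (_ : disk_complement c =
    (fun z : R * R => z.1 ^+ 2 + z.2 ^+ 2) @^-1` `[c, +oo[).
  by rewrite -[X in measurable X]setTI; exact: mh.
by apply/seteqP; split => z; rewrite /= in_itv/= andbT.
Qed.

Lemma preimage_normc_tail (c : R) :
  @complex_of_pair R @^-1` [set z | c <= Normc.normc z ^+ 2] = disk_complement c.
Proof.
by apply/seteqP; split => -[a b]/=; rewrite sqr_sqrtr// addr_ge0 ?sqr_ge0.
Qed.

Lemma measurable_normc_tail (c : R) :
  measurable [set z : R[i] | c <= Normc.normc z ^+ 2].
Proof.
rewrite /measurable/= /complex_measurable/= preimage_normc_tail.
exact: measurable_disk_complement.
Qed.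

(** The product of the two densities depends only on [x ^+ 2 + y ^+ 2], which brings the integral
    into radial form. *)
Lemma normal_prodE (s c : R) : 0 < s ->
  ((normal_prob 0 (Num.sqrt (s / 2)) \x normal_prob 0 (Num.sqrt (s / 2)))
      (disk_complement c) =
   (normal_peak (Num.sqrt (s / 2)) ^+ 2)%:E *
     \int[mu]_x \int[mu]_y (exp_tail s c (x ^+ 2 + y ^+ 2))%:E)%E.
Proof.
move=> s0; set sigma := Num.sqrt (s / 2).
have sigma0 : sigma != 0 by rewrite gt_eqF// sqrtr_gt0 divr_gt0.
(* The left side is the denominator in the exponent of the normal density. *)
have sigma2 : sigma ^+ 2 *+ 2 = s.
  rewrite sqr_sqrtr ?divr_ge0 ?ltW//.
  by rewrite -mulr_natr divfK.
have mA := measurable_disk_complement c.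
have mf : measurable_fun setT
    (fun x => normal_prob 0 sigma (xsection (disk_complement c) x)).
  exact: (measurable_fun_xsection (normal_prob 0 sigma) mA).
(* The product measure integrates the probabilities of the sections; these are at most 1, hence
   integrable. *)
rewrite /product_measure1 /= integral_normal_prob; last first.
  apply/integrableP; split => //.
  apply: (@le_lt_trans _ _ (\int[normal_prob 0 sigma]_x cst 1 x)%E).
    apply: ge0_le_integral => //; first exact: measurableT_comp.
    move=> x _; rewrite gee0_abs//= probability_le1//.
    exact: (measurable_xsection _ mA).
  by rewrite integral_cst//= mul1e probability_setT ltry.
have mt : measurable_fun setT
    (fun z : R * R => (exp_tail s c (z.1 ^+ 2 + z.2 ^+ 2))%:E).
  apply/measurable_EFinP; apply: measurableT_comp; first exact: measurable_exp_tail.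
  apply: measurable_funD; apply: measurable_funX.
    exact: measurable_fst.
  exact: measurable_snd.
have t0 (z : R * R) : (0 <= (exp_tail s c (z.1 ^+ 2 + z.2 ^+ 2))%:E)%E.
  by rewrite lee_fin exp_tail_ge0.
rewrite -ge0_integralZl//=; last 3 first.
- exact: (measurable_fun_fubini_tonelli_F (m2 := mu) _ mt).
- by move=> x _; apply: integral_ge0 => y _; exact: (t0 (x, y)).
- by rewrite lee_fin sqr_ge0.
apply: eq_integral => x _.
have mtx : measurable_fun setT (fun y : R => (exp_tail s c (x ^+ 2 + y ^+ 2))%:E).
  apply/measurable_EFinP; apply: measurableT_comp; first exact: measurable_exp_tail.
  exact: measurable_funD.
rewrite /normal_prob integral_mkcond -ge0_integralZr//=; last 3 first.
- apply/(measurable_restrictT _ _).1 => //; first exact: (measurable_xsection _ mA).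
  apply: measurable_funTS.
  by apply/measurable_EFinP; exact: measurable_normal_pdf.
- by move=> y _; apply: erestrict_ge0 => z _; rewrite lee_fin normal_pdf_ge0.
- by rewrite lee_fin normal_pdf_ge0.
rewrite -ge0_integralZl//=; last 2 first.
- by move=> y _; exact: (t0 (x, y)).
- by rewrite lee_fin sqr_ge0.
apply: eq_integral => y _.
rewrite patchE mem_xsection.
rewrite (_ : ((x, y) \in _) = (c <= x ^+ 2 + y ^+ 2)); last first.
  by apply/idP/idP; rewrite inE.
rewrite /exp_tail indicE mem_setE in_itv/= andbT.
case: ifPn => _; last by rewrite mul0e mulr0 mule0.
rewrite mulr1 !normal_pdfE// /normal_fun !subr0 sigma2 -!EFinM; congr EFin.
rewrite mulrACA -expr2 -expRD; congr (_ * expR _).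
by rewrite mulrDl opprD !mulNr addrC.
Qed.

Lemma complex_normal_tail (s c : R) : 0 < s -> 0 <= c ->
  complex_normal s [set z | c <= Normc.normc z ^+ 2] = (expR (- (c / s)))%:E.
Proof.
move=> s0 c0; set sigma := Num.sqrt (s / 2).
(* The statement is generalised over [c] so that it can be used at 0 as well; the factor before the
   exponential is the same for all [c]. *)
have tailE : forall c, 0 <= c ->
    ((normal_prob 0 sigma \x normal_prob 0 sigma) (disk_complement c) =
     (normal_peak sigma ^+ 2)%:E * (\int[mu]_u ((1 + u ^+ 2)^-1)%:E) *
     s%:E * (expR (- (c / s)))%:E)%E.
  move=> {c0}c c0; rewrite normal_prodE//.
  rewrite (integral_radial (f := EFin \o exp_tail s c)).
  - by rewrite integral_radial_exp_tail// (EFinM s) !muleA.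
  - by apply/measurable_EFinP; exact: measurable_exp_tail.
  - by move=> x; rewrite lee_fin exp_tail_ge0.
have := tailE 0 (lexx 0).
rewrite (_ : disk_complement 0 = setT); last first.
  by apply/seteqP; split=> // z _; rewrite /disk_complement /= addr_ge0 ?sqr_ge0.
(* The plane has mass 1, so [one] says that this common factor equals 1. *)
rewrite probability_setT mul0r oppr0 expR0 mule1 => one.
transitivity ((normal_prob 0 sigma \x normal_prob 0 sigma) (disk_complement c))%E.
  by rewrite /complex_normal /pushforward preimage_normc_tail.
by rewrite tailE// -one mul1e.
Qed.

End complex_normal_tail.

(** * Sublevel sets and measurability of the bit time *)

Section bit_time.
Variable R : realType.

Lemma bit_time_ge0 (rho : R) (z : R[i]) : 0 < rho -> (0 <= bit_time rho z)%E.
Proof.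
move=> rho0; rewrite inve_ge0 lee_fin divr_ge0 ?ln_ge0 ?ler1n//.
by rewrite lerDl mulr_ge0 ?sqr_ge0// ltW.
Qed.

Lemma bit_time_le (rho t : R) (z : R[i]) : 0 < rho -> 0 < t ->
  (bit_time rho z <= t%:E)%E = ((2 `^ (1 / t) - 1) / rho <= Normc.normc z ^+ 2).
Proof.
move=> rho0 t0; rewrite ler_pdivrMr// lerBlDl (mulrC (_ ^+ 2)) /bit_time.
set w := 1 + _.
have w1 : 1 <= w by rewrite lerDl mulr_ge0 ?sqr_ge0// ltW.
have ln2 : 0 < ln 2 :> R by rewrite ln_gt0// ltr1n.
have w0 : 0 <= log2 w by rewrite divr_ge0 ?(ltW ln2) ?ln_ge0.
have -> : (2 `^ (1 / t) <= w) = (t^-1 <= log2 w).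
  rewrite -[LHS]ler_ln ?posrE ?powR_gt0 ?(lt_le_trans ltr01) ?ler1n//.
  by rewrite ln_powR div1r /log2 ler_pdivlMr.
(* If the logarithm vanishes, the bit time is [+oo] and both sides are false, since [t^-1 > 0]. *)
rewrite inver; case: ifPn => [/eqP ->|wN0].
  by rewrite leye_eq/= invr_le0 leNgt t0.
by rewrite lee_fin -[in RHS]lef_pV2 ?invrK// posrE ?invr_gt0// lt_def wN0.
Qed.

Lemma measurable_bit_time (rho : R) : 0 < rho ->
  measurable_fun setT (bit_time rho).
Proof.
move=> rho0; apply: (measurability _ (ErealGenOInfty.measurableE R)).
move=> _ [_ [r ->] <-]; rewrite setTI preimage_itvoy.
rewrite [X in measurable X](_ : _ =
    ~` [set z | bit_time rho z <= r%:E]%E); last first.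
  by apply/seteqP; split=> z /=; [rewrite ltNge => /negP|move/negP; rewrite -ltNge].
apply: measurableC; have [r0|r0] := ltP 0 r.
  under eq_set do rewrite bit_time_le//.
  exact: measurable_normc_tail.
(* For [r <= 0] the sublevel set is empty: a bit time is [+oo] or the inverse of a positive real. *)
rewrite (_ : mkset _ = set0)//; apply/seteqP; split=> // z /=.
apply/negP; rewrite -ltNge; have := bit_time_ge0 z rho0.
rewrite /bit_time inver; case: ifPn => [|wN0]; first by rewrite ltry.
rewrite lee_fin lte_fin => w0; apply: (le_lt_trans r0).
by rewrite lt_def invr_eq0 wN0.
Qed.

End bit_time.

(** * From one device to [D] independent devices *)

Section deadline.
Variables (R : realType) (disp : measure_display) (T : measurableType disp).
Variables (P : probability T R) (L D : nat).
Hypothesis L_gt0 : (0 < L)%N.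
Variable rho : 'I_D -> R.
Hypothesis rho_gt0 : forall d, 0 < rho d.
Variable h : 'I_D -> {RV P >-> R[i]}.
Hypothesis h_law : forall d,
  has_law (h d) (complex_normal (1 - error_variance L (rho d))).
Hypothesis h_indep : independent_RVs h.

(** Having at least one pilot keeps the error variance below 1, so the law of [h d] is a
    nondegenerate Gaussian. *)
Lemma one_minus_error_variance_gt0 d : 0 < 1 - error_variance L (rho d).
Proof.
rewrite subr_gt0 /error_variance ltr_pdivrMr ?mul1r ?ltrDl ?mulr_gt0 ?ltr0n//.
by rewrite ltr_pwDl// mulr_ge0// ltW.
Qed.

Lemma prob_bit_time_le (t : R) d : 0 < t ->
  P [set u | bit_time (rho d) (h d u) <= t%:E]%E =
  (expR (- (noise_to_signal L (rho d) * (2 `^ (1 / t) - 1))))%:E.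
Proof.
move=> t0; under eq_set do rewrite bit_time_le//.
have s0 := one_minus_error_variance_gt0 d.
transitivity (distribution P (h d)
    [set z | (2 `^ (1 / t) - 1) / rho d <= Normc.normc z ^+ 2]) => //.
rewrite h_law; last exact: measurable_normc_tail.
rewrite complex_normal_tail//.
  rewrite /noise_to_signal; do 3 f_equal.
  by field; rewrite !gt_eqF.
(* The tail formula requires a nonnegative threshold, which follows from [2]^ (1 / t) >= 2
   [^ 0 = 1]. *)
rewrite divr_ge0 ?(ltW (rho_gt0 d))// subr_ge0 -[leLHS](powRr0 2) ler_powR ?ler1n//.
by rewrite divr_ge0// ltW.
Qed.

Lemma prob_all_bit_times_le (t : R) : (0 < D)%N -> 0 < t ->
  P [set u | forall d, bit_time (rho d) (h d u) <= t%:E]%E =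
  (expR (- (D%:R * mean_noise_to_signal L rho * (2 `^ (1 / t) - 1))))%:E.
Proof.
move=> D0 t0.
pose A d := [set z : R[i] | bit_time (rho d) z <= t%:E]%E.
have mA d : measurable (A d).
  rewrite -[A d]setTI; apply: emeasurable_fun_infty_c => //.
  exact: measurable_bit_time.
(* Independence over the full index set turns the probability into a product, whose exponents add up
   to [D] times the mean. *)
have := h_indep finset.setT mA.
rewrite (_ : \bigcap_(i in _) _ =
    [set u | forall d, bit_time (rho d) (h d u) <= t%:E]%E); last first.
  by apply/seteqP; split=> u /= Hu d => [|_]; apply: Hu; rewrite /= inE.
move=> ->; under eq_bigr do rewrite prob_bit_time_le//.
rewrite prodEFin -expR_sum; congr (expR _)%:E.
rewrite sumrN -mulr_suml /mean_noise_to_signal mulrA divff ?mul1r ?pnatr_eq0 -?lt0n//.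
by congr (- (_ * _)); apply: eq_bigl => d; rewrite inE.
Qed.

End deadline.

Theorem proposition5 (R : realType) (disp : measure_display)
    (T : measurableType disp) (P : probability T R) (L D : nat)
    (hL : (1 <= L)%N) (hD : (2 <= D)%N)
    (rho : 'I_D -> R) (rho_gt0 : forall d : 'I_D, 0 < rho d)
    (h : 'I_D -> {RV P >-> R[i]})
    (h_law : forall d : 'I_D,
      has_law (h d) (complex_normal (1 - error_variance L (rho d))))
    (h_indep : independent_RVs h)
    (y : R) (y_gt0 : 0 < y) :
  ((expR (- (D%:R * mean_noise_to_signal L rho * (2 `^ (D%:R / y) - 1))))%:E
     <= P [set t | \sum_(d < D) bit_time (rho d) (h d t) <= y%:E])%E
  /\
  (P [set t | \sum_(d < D) bit_time (rho d) (h d t) <= y%:E]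
     <= (expR (- (D%:R * mean_noise_to_signal L rho * (2 `^ (1 / y) - 1))))%:E)%E.
Proof.
have D0 : (0 < D)%N by exact: ltnW.
have DR0 : 0 < D%:R :> R by rewrite ltr0n.
have mY d : measurable_fun setT (fun u => bit_time (rho d) (h d u)).
  by apply: measurableT_comp; [exact: measurable_bit_time|exact: measurable_funP].
have mS : measurable [set u | \sum_(d < D) bit_time (rho d) (h d u) <= y%:E]%E.
  rewrite -[X in measurable X]setTI; apply: emeasurable_fun_infty_c => //.
  exact: emeasurable_sum.
have mE t : measurable [set u | forall d, bit_time (rho d) (h d u) <= t%:E]%E.
  rewrite (_ : mkset _ =
      \bigcap_(d in [set: 'I_D]) [set u | bit_time (rho d) (h d u) <= t%:E]%E).
    apply: fin_bigcap_measurable => // d _.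
    by rewrite -[X in measurable X]setTI; exact: emeasurable_fun_infty_c.
  by apply/seteqP; split=> u /= Hu d => [_|]; exact: Hu.
split.
(* The lower bound is the joint probability at [t = y / D], an equal share of the deadline for each
   device. *)
- rewrite (_ : D%:R / y = 1 / (y / D%:R)); last by rewrite div1r invf_div.
  rewrite -(prob_all_bit_times_le hL rho_gt0 h_law h_indep D0) ?divr_gt0//.
  apply: le_measure; rewrite ?inE// => u /= Hu.
  apply: (@le_trans _ _ (\sum_(d < D) (y / D%:R)%:E)%E).
    by apply: lee_sum => d _; exact: Hu.
  by rewrite sumEFin sumr_const card_ord -(mulr_natr (y / _)) divfK// gt_eqF.
- rewrite -(prob_all_bit_times_le hL rho_gt0 h_law h_indep D0)//.
  apply: le_measure; rewrite ?inE// => u /= Hu d.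
  (* Isolating the term [d] leaves a nonnegative remainder, so a single bit time is at most the
     sum. *)
  apply: le_trans Hu; rewrite (bigD1 d)//= leeDl// sume_ge0// => i _.
  exact: bit_time_ge0.
Qed.
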